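(* Let $\mathbb F$ be an algebraically closed field of characteristic different from $2$ and let $n\ge2$. The derivations of $\mathbf I_n$ are of the form (as matrices in the basis $e_1,\dots,e_n$) $$\begin{pmatrix} d & -d\,\mathbf i & -d_{23}\mathbf i &\ldots & -d_{2(n-1)}\mathbf i & -d_{2n}\mathbf i\\ d\,\mathbf i & d & d_{23}&\ldots & d_{2(n-1)} & d_{2n}\\ d_{23}\mathbf i & -d_{23} & d &\ldots & d_{3(n-1)} & d_{3n}\\ \vdots&\vdots&\vdots&\ddots&\vdots&\vdots\\ d_{2(n-1)}\mathbf i & -d_{2(n-1)} & -d_{3(n-1)}&\ldots & d & d_{(n-1)n}\\ d_{2n}\mathbf i & -d_{2n} & -d_{3n}&\ldots & -d_{(n-1)n} & d \end{pmatrix},$$ with $d$ and $d_{ij}$ ($2\le i<j\le n$, $j\ge 3$) in $\mathbb F$. Moreover, $\dim\mathfrak{Der}(\mathbf I_n)=\frac{(n-1)(n-2)}{2}+1$.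
   Context: $\mathbf i\in\mathbb F$ is a fixed element with $\mathbf i^2=-1$. For $n\ge2$, $\mathbf I_n$ is the $n$-dimensional algebra over $\mathbb F$ with basis $e_1,\dots,e_n$ and products $e_1^2=\dots=e_n^2=e_1+\mathbf i e_2$, $e_ie_j=0$ for $i\ne j$. A derivation is a linear map $\mathfrak D$ with $\mathfrak D(xy)=\mathfrak D(x)y+x\mathfrak D(y)$; its matrix $(d_{ij})$ is given by $\mathfrak D(e_j)=\sum_i d_{ij}e_i$. $\mathfrak{Der}(\mathbf I_n)$ is the vector space of all derivations. *)

(* Defs.v *)
(* MathComp. *)
From HB Require Import structures.
From mathcomp Require Import all_boot all_order all_algebra.

Set Implicit Arguments.
Unset Strict Implicit.
Unset Printing Implicit Defensive.

Import GRing.Theory.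
Local Open Scope ring_scope.

(* Indices are 1-based: the basis of 'cV[F]_n is ebas n 1, ..., ebas n n, so
   that the k-th basis vector has its 1 in the row i : 'I_n with i.+1 = k. *)
Definition ebas (F : fieldType) (n k : nat) : 'cV[F]_n :=
  \col_i (i.+1 == k)%:R.

(* The algebra I_n is 'cV[F]_n with the bilinear product determined by
   e_i e_i = e_1 + im e_2 and e_i e_j = 0 for i <> j.  It is neither
   associative nor unital, so it is not a MathComp algType. *)
Definition In_mul (F : fieldType) (im : F) (n : nat) (x y : 'cV[F]_n) :
    'cV[F]_n :=
  \sum_(i < n) \sum_(j < n) (x i 0 * y j 0) *:
    (if i == j then ebas F n 1 + im *: ebas F n 2 else 0).

Definition is_derivation (F : fieldType) (V : vectType F) (mul : V -> V -> V)
    (D : 'End(V)) : Prop :=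
  forall x y : V, D (mul x y) = mul (D x) y + mul x (D y).

Definition matrix_of (F : fieldType) (n : nat) (D : 'End('cV[F]_n)) :
    'M[F]_n :=
  \matrix_(i, j) D (ebas F n j.+1) i 0.

Definition leibniz_defect (F : fieldType) (im : F) (n : nat) (x y : 'cV[F]_n)
    (D : 'End('cV[F]_n)) : 'cV[F]_n :=
  D (In_mul im x y) - (In_mul im (D x) y + In_mul im x (D y)).

(* The Leibniz rule is imposed on basis vectors only; by mem_Der below, Der
   consists of exactly the derivations of I_n. *)
Definition Der (F : fieldType) (im : F) (n : nat) :
    {vspace 'End('cV[F]_n)} :=
  (\bigcap_(i < n) \bigcap_(j < n)
     lker (linfun (leibniz_defect im (ebas F n i.+1) (ebas F n j.+1))))%VS.

(* The (i, j) entry, 1 <= i, j <= n, of the general derivation matrix; only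
   the values c i j with 2 <= i < j <= n are used. *)
Definition der_entry (F : fieldType) (im d : F) (c : nat -> nat -> F)
    (i j : nat) : F :=
  if i == j then d
  else if (i == 1)%N && (j == 2)%N then - d * im
  else if (i == 2)%N && (j == 1)%N then d * im
  else if (i == 1)%N then - c 2%N j * im
  else if (j == 1)%N then c 2%N i * im
  else if (i < j)%N then c i j
  else - c j i.

Definition der_matrix (F : fieldType) (im : F) (n : nat) (d : F)
    (c : nat -> nat -> F) : 'M[F]_n :=
  \matrix_(i, j) der_entry im d c i.+1 j.+1.

Section Facts.
Variables (F : fieldType) (im : F) (n : nat).
Implicit Types (x y : 'cV[F]_n) (D : 'End('cV[F]_n)).

Lemma In_mulE x y :
  In_mul im x y =
  (\sum_i x i 0 * y i 0) *: (ebas F n 1 + im *: ebas F n 2).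
Proof.
rewrite scaler_suml; apply: eq_bigr => i _.
rewrite (bigD1 i) //= eqxx big1 ?addr0 // => j ji.
by rewrite eq_sym (negPf ji) scaler0.
Qed.

Lemma In_mulC x y : In_mul im x y = In_mul im y x.
Proof. by rewrite !In_mulE; under eq_bigr do rewrite mulrC. Qed.

Lemma In_mul_is_linear x : linear (In_mul im x).
Proof.
move=> a y z; rewrite !In_mulE scalerA -scalerDl mulr_sumr -big_split /=.
by congr (_ *: _); apply: eq_bigr => i _; rewrite !mxE mulrDr mulrCA.
Qed.

HB.instance Definition _ x :=
  GRing.isLinear.Build F 'cV[F]_n 'cV[F]_n *:%R (In_mul im x)
    (In_mul_is_linear x).

Lemma ebas_sum x : x = \sum_i x i 0 *: ebas F n i.+1.
Proof.
apply/colP=> k; rewrite summxE (bigD1 k) //= !mxE eqxx mulr1 big1 ?addr0 //.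
by move=> i ik; rewrite !mxE eqSS (inj_eq val_inj) eq_sym (negPf ik) mulr0.
Qed.

Lemma In_mul_ebas (i j : 'I_n) :
  In_mul im (ebas F n i.+1) (ebas F n j.+1) =
  if i == j then ebas F n 1 + im *: ebas F n 2 else 0.
Proof.
rewrite In_mulE (bigD1 i) //= big1 => [|k ki].
  rewrite !mxE eqxx mul1r addr0 eqSS (inj_eq val_inj).
  by case: eqP; rewrite ?scale1r ?scale0r.
by rewrite !mxE eqSS (inj_eq val_inj) (negPf ki) mul0r.
Qed.

Lemma leibniz_defect_is_linear x y : linear (leibniz_defect im x y).
Proof.
move=> a D E; rewrite /leibniz_defect !add_lfunE !scale_lfunE.
rewrite ![In_mul _ _ y]In_mulC !linearP /= scalerBr scalerDr.
by rewrite [X in _ - X]addrACA opprD addrACA.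
Qed.

HB.instance Definition _ x y :=
  GRing.isLinear.Build F 'End('cV[F]_n) 'cV[F]_n *:%R
    (leibniz_defect im x y) (leibniz_defect_is_linear x y).

Lemma leibniz_defectC x y D :
  leibniz_defect im x y D = leibniz_defect im y x D.
Proof.
by rewrite /leibniz_defect addrC ![In_mul _ _ y]In_mulC
  ![In_mul _ x _]In_mulC [in RHS]addrC [X in - X]addrC.
Qed.

Lemma leibniz_defect_linear_r x D :
  linear (fun y => leibniz_defect im x y D).
Proof.
move=> a y z; rewrite /leibniz_defect !linearP /= scalerBr scalerDr.
by rewrite [X in _ - X]addrACA opprD addrACA.
Qed.

Lemma mem_Der D : D \in Der im n <-> is_derivation (@In_mul F im n) D.
Proof.
have DerE : D \in Der im n <->
    forall i j : 'I_n, leibniz_defect im (ebas F n i.+1) (ebas F n j.+1) D = 0.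
  rewrite memvE; split=> [/subv_bigcapP h i j|h].
    have /subv_bigcapP/(_ j isT) := h i isT.
    by rewrite -memvE memv_ker lfunE /= => /eqP.
  apply/subv_bigcapP=> i _; apply/subv_bigcapP=> j _.
  by rewrite -memvE memv_ker lfunE /= h.
split=> [/DerE h x y|h]; last first.
  by apply/DerE => i j; rewrite /leibniz_defect h subrr.
have hr x' y' : (forall j : 'I_n, leibniz_defect im x' (ebas F n j.+1) D = 0) ->
    leibniz_defect im x' y' D = 0.
  move=> hx; have hl := leibniz_defect_linear_r x' D.
  have h0 : leibniz_defect im x' 0 D = 0.
    by have := hl (-1) 0 0; rewrite scaler0 addr0 scaleN1r addNr.
  rewrite (ebas_sum y'); elim/big_ind: _ => [//|u v hu hv|j _].
    by have := hl 1 u v; rewrite hu hv !scale1r addr0.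
  by have := hl (y' j 0) (ebas F n j.+1) 0; rewrite hx h0 !addr0 scaler0.
apply/eqP; rewrite -subr_eq0; apply/eqP; apply: (hr) => j.
by rewrite leibniz_defectC; apply: hr => i; rewrite leibniz_defectC.
Qed.

End Facts.

(* Main.v *)
(** Write [w = e_1 + i e_2] and [B(x, y) = sum_k x_k y_k], so that the product
    of [I_n] is [B(x, y) w].  A linear map with matrix [M] is a derivation iff
    [B(x, y) M w = B(x, (M^T + M) y) w] for all [x] and [y], that is, iff
    [M + M^T = a I] and [M w = a w] for some scalar [a].  The first condition
    says that [M] is [a / 2] plus a skew-symmetric matrix, and the second one
    determines the first column from the second one.  Hence a derivation is
    determined by its first entry and by its entries strictly above the
    diagonal outside the first row, and these may be chosen freely. *)
From HB Require Import structures.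
Require Import Defs.
From mathcomp Require Import all_boot all_order all_algebra ring.

Import GRing.Theory.
Local Open Scope ring_scope.

Lemma der_entry_skew (F : fieldType) (im d : F) (c : nat -> nat -> F) i j :
  i.+1 != j.+1 -> der_entry im d c i.+1 j.+1 = - der_entry im d c j.+1 i.+1.
Proof.
wlog lt_ij : i j / (i < j)%N => [hwlog ij|_].
  have [lt_ij|lt_ji|eq_ij] := ltngtP i j; first exact: hwlog.
    by rewrite [in RHS]hwlog ?opprK // eq_sym.
  by rewrite eq_ij eqxx in ij.
rewrite /der_entry !eqSS !ltnS (ltn_eqF lt_ij) (gtn_eqF lt_ij) lt_ij.
rewrite (leq_gtF (ltnW lt_ij)) /=.
by case: i j lt_ij => [|[|i]] [|[|j]] //= _; rewrite ?mulNr ?opprK.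
Qed.

(** * Derivations in terms of their matrices *)

Section DerivationMatrix.
Variables (F : fieldType) (im : F) (m : nat).
Local Notation n := m.+2.
Implicit Types (x y : 'cV[F]_n) (D : 'End('cV[F]_n)) (M : 'M[F]_n).

Let w : 'cV[F]_n := ebas F n 1 + im *: ebas F n 2.

Lemma matrix_ofP D x : D x = matrix_of D *m x.
Proof.
rewrite {1}(ebas_sum x) linear_sum; apply/colP=> i; rewrite summxE mxE.
by apply: eq_bigr => j _; rewrite linearZ /= !mxE mulrC.
Qed.

Lemma matrix_of_mulmx M : matrix_of (linfun (mulmx M)) = M.
Proof.
apply/matrixP=> i j; rewrite mxE lfunE /= mxE (bigD1 j) //= !mxE eqxx mulr1.
rewrite big1 ?addr0 // => k kj.
by rewrite !mxE eqSS (inj_eq val_inj) (negPf kj) mulr0.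
Qed.

Lemma In_mul_form x y : In_mul im x y = (x^T *m y) 0 0 *: w.
Proof. by rewrite In_mulE mxE; under [in RHS]eq_bigr do rewrite mxE. Qed.

Lemma mulmx_w M i : (M *m w) i 0 = M i 0 + im * M i 1.
Proof.
rewrite mxE big_ord_recl big_ord_recl big1 => [|j _].
  rewrite !mxE /= mulr0 addr0 add0r !mulr1 addr0 mulrC.
  by congr (M i _ + _ * M i _); apply: val_inj.
by rewrite !mxE /= mulr0 addr0 mulr0.
Qed.

Lemma derivation_skewP D :
  is_derivation (@In_mul F im n) D <->
  let M := matrix_of D in
  exists2 a, M + M^T = a%:M & M *m w = a *: w.
Proof.
set M := matrix_of D.
have leibnizE x y : In_mul im (D x) y + In_mul im x (D y) =
    (x^T *m (M + M^T) *m y) 0 0 *: w.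
  rewrite !In_mul_form -scalerDl !matrix_ofP -/M trmx_mul mulmxDr mulmxDl.
  by rewrite -!mulmxA [in RHS]mxE addrC.
split=> [hD|[a hskew hw] x y]; last first.
  rewrite leibnizE hskew mul_mx_scalar -scalemxAl mxE In_mul_form linearZ /=.
  by rewrite matrix_ofP -/M hw scalerA mulrC.
have dotE (i j : 'I_n) :
    ((ebas F n i.+1)^T *m ebas F n j.+1) 0 0 = (i == j)%:R.
  rewrite mxE (bigD1 i) //= big1 => [|k ki].
    by rewrite !mxE eqxx mul1r addr0 eqSS (inj_eq val_inj).
  by rewrite !mxE !eqSS (inj_eq val_inj) (negPf ki) mul0r.
have entryE (N : 'M_n) (i j : 'I_n) :
    ((ebas F n i.+1)^T *m N *m ebas F n j.+1) 0 0 = N i j.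
  have ebasE (k : 'I_n) : ebas F n k.+1 = delta_mx k 0.
    by apply/colP=> l; rewrite !mxE eqSS (inj_eq val_inj) andbT.
  by rewrite !ebasE trmx_delta -colE -rowE !mxE.
(* Tested on basis vectors, the Leibniz rule makes a multiple of [M *m w] equal to a multiple of
   [w], for every pair [i], [j]. *)
have hij i j : (i == j)%:R *: (M *m w) = (M + M^T) i j *: w.
  have := hD (ebas F n i.+1) (ebas F n j.+1).
  by rewrite leibnizE entryE In_mul_form dotE linearZ /= matrix_ofP -/M.
(* As [w] has first coordinate 1, scalars in front of it can be compared; the pair (0, 0) forces the
   value of [a]. *)
have w0 : w 0 0 = 1 by rewrite !mxE /= mulr0 addr0.
exists ((M + M^T) 0 0); last by rewrite -hij scale1r.
apply/matrixP=> i j; have := hij i j.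
have -> : M *m w = (M + M^T) 0 0 *: w by rewrite -hij eqxx scale1r.
move/colP/(_ 0); rewrite [LHS]mxE [X in _ * X]mxE [RHS]mxE w0 !mulr1 => <-.
by rewrite [RHS]mxE mulr_natl.
Qed.

Hypotheses (char2 : 2%:R != 0 :> F) (im2 : im ^+ 2 = -1).

Lemma skew_der_matrixP M :
  (exists2 a, M + M^T = a%:M & M *m w = a *: w) <->
  exists (d : F) (c : nat -> nat -> F), M = der_matrix im n d c.
Proof.
split=> [[a hs hw]|[d [c ->]]].
  have skew i j : M i j + M j i = a *+ (i == j).
    by move/matrixP/(_ i j): hs; rewrite !mxE.
  have eigen i : M i 0 + im * M i 1 = a * w i 0.
    by move/colP/(_ i): hw; rewrite mulmx_w mxE.
  have aE : a = M 0 0 + M 0 0 by rewrite skew.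
  have w0 : w 0 0 = 1 by rewrite !mxE /= mulr0 addr0.
  have skewN i j : i != j -> M i j = - M j i.
    by move=> /negPf ij; apply/eqP; rewrite -addr_eq0 skew ij.
  (* The first coordinate of [M *m w = a *: w] with [a = 2 M 0 0] leaves [im * M 0 1 = M 0 0];
     multiply by [- im]. *)
  have M01 : M 0 1 = - M 0 0 * im.
    have := eigen 0; rewrite aE w0 mulr1 => /addrI <-.
    by rewrite mulrC mulrN mulrA -expr2 im2 mulN1r opprK.
  (* In these rows [w] vanishes, so [M i 0 = - im * M i 1], and skewness moves the entry into row
     1. *)
  have col0 (i : 'I_n) : (1 < i)%N -> M i 0 = M 1 i * im.
    case: i => [[|[|k]] hk] // _; have := eigen (Ordinal hk).
    rewrite !mxE /= !mulr0 addr0 mulr0 (skewN _ 1) // => /eqP.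
    by rewrite mulrN subr_eq0 mulrC => /eqP.
  (* The indices of [c] start at 1 and those of [M] at 0, hence the predecessors. *)
  exists (M 0 0), (fun k l => M (inord k.-1) (inord l.-1)).
  have inord1 : inord 1 = 1 :> 'I_n by apply: val_inj; rewrite /= inordK.
  apply/matrixP=> i j; rewrite mxE /der_entry !eqSS /= !inord_val inord1.
  rewrite (inj_eq val_inj); case: eqVneq => [<-|ij].
    (* Twice any diagonal entry is [a], so all of them agree once 2 is cancelled. *)
    apply: (mulfI char2); rewrite !mulr_natl !mulr2n.
    by rewrite !skew !eqxx.
  have ordE0 (k : 'I_n) : val k = 0%N -> k = 0 by move=> ?; apply: val_inj.
  have ordE1 (k : 'I_n) : val k = 1%N -> k = 1 by move=> ?; apply: val_inj.
  have gt1 (k : 'I_n) : val k != 0%N -> val k != 1%N -> (1 < k)%N.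
    by case: k => [[|[]]].
  case: (eqVneq (val i) 0%N) => [/ordE0 i0|i0] /=.
    rewrite i0 in ij *; case: (eqVneq (val j) 1%N) => [/ordE1 ->|j1] //=.
    rewrite skewN // col0 ?mulNr //.
    by apply: gt1 => //; rewrite eq_sym.
  rewrite andbC; case: (eqVneq (val j) 0%N) => [/ordE0 j0|j0] /=.
    rewrite j0; case: (eqVneq (val i) 1%N) => [/ordE1 ->|i1] /=.
      by rewrite skewN // M01 mulNr opprK.
    by rewrite col0 //; apply: gt1.
  by rewrite ltnS; case: ltnP => // _; rewrite skewN.
exists (d + d).
  apply/matrixP=> i j; rewrite !mxE; case: eqVneq => [->|ij].
    by rewrite /der_entry eqxx.
  by rewrite der_entry_skew ?addNr // eqSS.
apply/colP=> i; rewrite mulmx_w !mxE /der_entry.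
(* Coordinate 0 needs [im ^+ 2 = -1]; in coordinate 1 both sides are [2 d im], and in the others
   both are 0. *)
case: i => [[|[|i]] hi] /=.
- by ring: im2.
- by ring.
by ring.
Qed.

End DerivationMatrix.

(** Grouping the pairs by their larger entry [j] gives [j] pairs for each [j < k]. This will count
    the free entries above the diagonal. *)
Lemma card_ord_lt_pairs k :
  #|[pred p : 'I_k * 'I_k | (p.1 < p.2)%N]| = 'C(k, 2).
Proof.
rewrite -sum1_card -bin2_sum big_mkord.
rewrite -(pair_big_dep xpredT (fun i j : 'I_k => (i < j)%N) (fun _ _ => 1%N)) /=.
rewrite (exchange_big_dep xpredT) //=; apply: eq_bigr => j _.
by rewrite -(big_ord_widen k (fun=> 1%N) (ltnW (ltn_ord j))) sum1_card card_ord.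
Qed.

(** * The free entries as linear coordinates on the space of derivations *)

Section DerivationDimension.
Variables (F : fieldType) (im : F) (m : nat).
Local Notation n := m.+2.
Hypotheses (char2 : 2%:R != 0 :> F) (im2 : im ^+ 2 = -1).

Lemma derivation_matrixP (D : 'End('cV[F]_n)) :
  is_derivation (@In_mul F im n) D <->
  exists (d : F) (c : nat -> nat -> F), matrix_of D = der_matrix im n d c.
Proof. by rewrite derivation_skewP; apply: skew_der_matrixP. Qed.

Let P := {p : 'I_m.+1 * 'I_m.+1 | (p.1 < p.2)%N}.

(* The pair [p] stands for the free entry [d_(p.1 + 2, p.2 + 2)]. *)
Definition free_entries (D : 'End('cV[F]_n)) : F^o * {ffun P -> F^o} :=
  let M := matrix_of D in
  (M 0 0, [ffun p : P => M (lift ord0 (val p).1) (lift ord0 (val p).2)]).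

Lemma free_entries_is_linear : linear free_entries.
Proof.
move=> a D E; congr (_, _).
  by rewrite /= !mxE add_lfunE scale_lfunE !mxE.
apply: (iffLR (ffunP _ _)) => p.
by rewrite /= !ffunE !mxE add_lfunE scale_lfunE !mxE.
Qed.

HB.instance Definition _ :=
  GRing.isLinear.Build F 'End('cV[F]_n) (F^o * {ffun P -> F^o})%type *:%R
    free_entries free_entries_is_linear.

(** Each entry of [der_matrix] is, up to sign and a factor [im], either [d] or some [c k l] with
    [2 <= k < l <= n], and these are exactly the coordinates. *)
Lemma der_free_entries0 D : D \in Der im n -> free_entries D = 0 -> D = 0.
Proof.
move/mem_Der/derivation_matrixP => [d [c MD]] [M00 /ffunP Mfree].
have d0 : d = 0 by move: M00; rewrite MD mxE.
have c0 k l : (k < l < m.+1)%N -> c k.+2 l.+2 = 0.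
  case/andP=> kl lm; pose p : P :=
    exist _ (Ordinal (ltn_trans kl lm), Ordinal lm) kl.
  have := Mfree p; rewrite !ffunE MD mxE /= /der_entry /= !eqSS (ltn_eqF kl).
  by rewrite !ltnS kl /bump !add1n andbF.
suff M0 : matrix_of D = 0.
  apply: (iffLR (lfunP _ _)) => x.
  by rewrite matrix_ofP M0 mul0mx zero_lfunE.
rewrite MD d0; apply/matrixP=> i j; rewrite !mxE /der_entry !eqSS !ltnS.
case: i j => [[|[|i]] hi] [[|[|j]] hj] /=; rewrite ?mul0r ?oppr0 ?mul0r //.
- by rewrite c0 ?oppr0 ?mul0r.
- by rewrite c0.
- by rewrite c0 ?mul0r.
- by rewrite c0 ?oppr0.
rewrite !eqSS !ltnS; case: ltngtP => // ij; first by rewrite c0 // ltnS ij.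
by rewrite c0 ?oppr0 // ltnS ij.
Qed.

Lemma der_free_entries_surj u : exists2 D, D \in Der im n & free_entries D = u.
Proof.
case: u => d f.
(* [c] extends [f] by zero to all pairs of naturals: at most one indicator in the sum is nonzero. *)
pose c k l := \sum_(p : P)
  f p * (((val p).1.+2 == k) && ((val p).2.+2 == l))%:R.
exists (linfun (mulmx (der_matrix im n d c))).
  by apply/mem_Der/derivation_matrixP; exists d, c; rewrite matrix_of_mulmx.
congr (_, _); first by rewrite matrix_of_mulmx mxE.
apply/ffunP=> p; rewrite ffunE matrix_of_mulmx mxE /= /der_entry !eqSS.
rewrite (ltn_eqF (valP p)) /= !ltnS (valP p) /bump !add1n andbF.
rewrite /c (bigD1 p) //= !eqxx mulr1 big1 ?addr0 // => q qp.
rewrite !eqSS; case: andP => [[/eqP q1 /eqP q2]|_]; last by rewrite mulr0.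
case/eqP: qp; apply: val_inj; apply/eqP.
by rewrite -pair_eqE; apply/andP; split; apply/eqP; apply: val_inj.
Qed.

(** [free_entries] maps [Der im n] bijectively onto its codomain, which has one dimension for [d]
    and one for each pair in [P]. *)
Lemma dim_Der : \dim (Der im n) = ('C(m.+1, 2) + 1)%N.
Proof.
pose g := linfun free_entries.
have <- : \dim (g @: Der im n) = \dim (Der im n).
  apply: limg_dim_eq; apply/eqP; rewrite -subv0; apply/subvP=> D.
  rewrite memv_cap memv_ker memv0 lfunE /= => /andP[hD /eqP h0].
  by rewrite (der_free_entries0 _ hD h0).
have -> : (g @: Der im n)%VS = fullv.
  apply/eqP; rewrite eqEsubv subvf; apply/subvP=> u _.
  have [D hD <-] := der_free_entries_surj u.
  by apply/memv_imgP; exists D => //; rewrite lfunE.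
by rewrite addnC -card_ord_lt_pairs -card_sig -[#|_|]muln1 dimvf.
Qed.

End DerivationDimension.

Theorem lemma33 (F : closedFieldType) (hchar : 2%N \notin [pchar F])
    (im : F) (him : im ^+ 2 = -1) (n : nat) (hn : (2 <= n)%N) :
  (forall D : 'End('cV[F]_n),
     is_derivation (@In_mul F im n) D <->
     exists (d : F) (c : nat -> nat -> F),
       matrix_of D = der_matrix im n d c) /\
  \dim (Der im n) = ((n - 1) * (n - 2) %/ 2 + 1)%N.
Proof.
have char2 : 2%:R != 0 :> F by apply: contra hchar => h; rewrite inE /= h.
case: n hn => [|[|m]] // _; split; first exact: derivation_matrixP.
by rewrite dim_Der // !subSS !subn0 bin2 divn2.
Qed.
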